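(* Let $G$ be a finite set. Sesquiunital sesquialgebra structures of finite free type on $k^G$ (up to isomorphism of the coproduct bimodule and counit module) are in one-to-one correspondence with unital ring structures on the free abelian group $\mathbb Z^G$ (with basis $G$) whose structure constants and whose unit's coordinates are all nonnegative integers; the correspondence sends $(\boldsymbol\Delta,\boldsymbol\epsilon)$ to the multiplication $h\cdot k=\sum_g d^g_{hk}\,g$ with unit $e=\sum_g e^g g$.
   Context: $k$ is a field, $\otimes=\otimes_k$. $G$ is a finite set, $A=k^G$ is the commutative algebra of $k$-valued functions on $G$ (pointwise operations); identify $A^{\otimes r}$ with $k^{G^r}$ and $A^{op}$ with $A$; $\delta_x$ is the characteristic function of $x$. A sesquiunital sesquialgebra on $A$ is an $(A\otimes A,A)$-bimodule $\boldsymbol\Delta$ and a right $A$-module $\boldsymbol\epsilon$ with $(A\otimes\boldsymbol\Delta)\otimes_{A\otimes A}\boldsymbol\Delta\cong(\boldsymbol\Delta\otimes A)\otimes_{A\otimes A}\boldsymbol\Delta$ and $(\boldsymbol\epsilon\otimes A)\otimes_{A\otimes A}\boldsymbol\Delta\cong A\cong(A\otimes\boldsymbol\epsilon)\otimes_{A\otimes A}\boldsymbol\Delta$ as bimodules. Since $\boldsymbol\Delta$ is a $k^{G^3}$-module, $\boldsymbol\Delta=\bigoplus_{g,h,k\in G}\boldsymbol\Delta^g_{hk}$ with $\boldsymbol\Delta^g_{hk}=(\delta_h\otimes\delta_k)\boldsymbol\Delta\,\delta_g$; similarly $\boldsymbol\epsilon=\bigoplus_g\boldsymbol\epsilon^g$,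 $\boldsymbol\epsilon^g=\boldsymbol\epsilon\,\delta_g$. The structure is of finite free type if all these components are finite-dimensional; put $d^g_{hk}=\dim\boldsymbol\Delta^g_{hk}$ and $e^g=\dim\boldsymbol\epsilon^g$. *)

(* Defs.v *)
From HB Require Import structures.
From mathcomp Require Import all_boot all_order all_algebra.
From mathcomp Require Export mxtens.

Set Implicit Arguments.
Unset Strict Implicit.
Unset Printing Implicit Defensive.

Import GRing.Theory.
Local Open Scope ring_scope.

(* For a finite set X, k^X is the algebra of k-valued functions on X; for     *)
(* finite L, R an (k^L, k^R)-bimodule (k acting centrally) is the same thing  *)
(* as a k^(L*R)-module.  With A = k^G we identify A^{(x)r} = k^(G^r) as in    *)
(* the paper (using iterated pair types).  Modules of "finite free type" are  *)
(* finite dimensional (G is finite), so we realise their underlying space as  *)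
(* row vectors 'rV[k]_n, the module acting on the right (v |-> v *m _).       *)
(* A module is recorded by the images fop M x of the basis idempotents        *)
(* delta_x of k^X; the action of f in k^X is  fact M f = \sum_x f x *: fop M x *)

Section Defs.
Variable k : fieldType.

Record fmod (X : finType) := FMod { fdim : nat; fop : X -> 'M[k]_fdim }.

Definition fact (X : finType) (M : fmod X) (f : {ffun X -> k}) : 'M[k]_(fdim M) :=
  \sum_x f x *: fop M x.

Definition is_fmod (X : finType) (M : fmod X) : Prop :=
  (forall f g : {ffun X -> k},
      fact M [ffun x => f x * g x] = fact M f *m fact M g)
  /\ fact M [ffun=> 1] = 1%:M.

(* A quotient of a finite-dimensional k^X-module: the space 'rV_qdim modulo  *)
(* the row space of qsub, with action induced by qop (which is assumed to    *)
(* preserve qsub in the constructions below).                                *)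
Record qmod (X : finType) := QMod { qdim : nat; qsub : 'M[k]_qdim; qop : X -> 'M[k]_qdim }.

Definition qmod_of (X : finType) (M : fmod X) : qmod X := @QMod X (fdim M) 0 (fop M).

(* Isomorphism of the quotient modules M and N, where the index types are     *)
(* identified through the bijection f : X -> Y (i.e. through the algebra      *)
(* isomorphism delta_x |-> delta_(f x)).  F is a linear map inducing a        *)
(* bijection of the quotients which is equivariant.                           *)
Definition qiso (X Y : finType) (f : X -> Y) (M : qmod X) (N : qmod Y) : Prop :=
  exists F : 'M[k]_(qdim M, qdim N),
    [/\ (qsub M *m F <= qsub N)%MS,
        forall x, qop M x *m F = F *m qop N (f x),
        (1%:M <= F + qsub N)%MS
      & forall v : 'rV[k]_(qdim M), (v *m F <= qsub N)%MS -> (v <= qsub M)%MS].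

Definition etens (L1 R1 L2 R2 : finType) (M : fmod (L1 * R1)%type) (N : fmod (L2 * R2)%type)
  : fmod ((L1 * L2) * (R1 * R2))%type :=
  @FMod _ (fdim M * fdim N)
    (fun x => fop M (x.1.1, x.2.1) *t fop N (x.1.2, x.2.2)).

Definition lact (L R : finType) (M : fmod (L * R)%type) (l : L) : 'M[k]_(fdim M) :=
  \sum_(r : R) fop M (l, r).
Definition ract (L R : finType) (M : fmod (L * R)%type) (r : R) : 'M[k]_(fdim M) :=
  \sum_(l : L) fop M (l, r).

(* Tensor product over k^Mi of an (L,Mi)-bimodule M and an (Mi,R)-bimodule N: *)
(* M (x)_k N modulo the span of all  m.b (x) n - m (x) b.n  (b = delta_y      *)
(* suffices by linearity), with the induced (L,R)-bimodule structure.        *)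
Definition tens_over (L Mi R : finType) (M : fmod (L * Mi)%type) (N : fmod (Mi * R)%type)
  : qmod (L * R)%type :=
  @QMod _ (fdim M * fdim N)
    (\sum_(y : Mi) (ract M y *t (1%:M : 'M[k]_(fdim N))
                   - (1%:M : 'M[k]_(fdim M)) *t lact N y))%MS
    (fun x => lact M x.1 *t ract N x.2).

(* the regular (A,A)-bimodule A = k^G, with basis delta_c (c : G) *)
Definition regA (G : finType) : fmod (G * G)%type :=
  @FMod _ #|G| (fun x => if x.1 == x.2
                          then delta_mx (enum_rank x.1) (enum_rank x.1) else 0).

(* a right A-module viewed as a (k, A)-bimodule  (k = k^unit) *)
Definition as_right (G : finType) (E : fmod G) : fmod (unit * G)%type :=
  @FMod _ (fdim E) (fun x => fop E x.2).

Section Sesqui.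
Variable G : finType.

(* Delta : (A(x)A, A)-bimodule, index ((h,k),g) ; Eps : right A-module. *)
Definition assoc_idx (x : ((G * (G * G)) * G)%type) : (((G * G) * G) * G)%type :=
  (((x.1.1, x.1.2.1), x.1.2.2), x.2).
Definition lunit_idx (x : ((unit * G) * G)%type) : (G * G)%type := (x.1.2, x.2).
Definition runit_idx (x : ((G * unit) * G)%type) : (G * G)%type := (x.1.1, x.2).

Definition sesquialgebra (D : fmod ((G * G) * G)%type) (E : fmod G) : Prop :=
  [/\ is_fmod D, is_fmod E,
      (* (A (x) D) (x)_{A(x)A} D  ~=  (D (x) A) (x)_{A(x)A} D *)
      qiso assoc_idx (tens_over (etens (regA G) D) D)
                     (tens_over (etens D (regA G)) D),
      (* (E (x) A) (x)_{A(x)A} D  ~=  A *)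
      qiso lunit_idx (tens_over (etens (as_right E) (regA G)) D) (qmod_of (regA G))
    & (* (A (x) E) (x)_{A(x)A} D  ~=  A *)
      qiso runit_idx (tens_over (etens (regA G) (as_right E)) D) (qmod_of (regA G))].

Definition dcoef (D : fmod ((G * G) * G)%type) (h k0 g : G) : nat := \rank (fop D ((h, k0), g)).
Definition ecoef (E : fmod G) (g : G) : nat := \rank (fop E g).

Definition sesqui_iso (D D' : fmod ((G * G) * G)%type) (E E' : fmod G) : Prop :=
  qiso id (qmod_of D) (qmod_of D') /\ qiso id (qmod_of E) (qmod_of E').

Definition ZG := {ffun G -> int}.
Definition gbasis (g : G) : ZG := [ffun x => (x == g)%:Z].

Definition unital_ring_on (mul : ZG -> ZG -> ZG) (e : ZG) : Prop :=
  [/\ forall a b c, mul (a + b) c = mul a c + mul b c,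
      forall a b c, mul a (b + c) = mul a b + mul a c,
      forall a b c, mul (mul a b) c = mul a (mul b c),
      forall a, mul e a = a
    & forall a, mul a e = a].

Definition nonneg_consts (mul : ZG -> ZG -> ZG) (e : ZG) : Prop :=
  (forall h k0 g, 0 <= mul (gbasis h) (gbasis k0) g) /\ (forall g, 0 <= e g).

Definition mul_of (D : fmod ((G * G) * G)%type) (a b : ZG) : ZG :=
  [ffun g => \sum_(h : G) \sum_(k0 : G) a h * b k0 * (dcoef D h k0 g)%:Z].
Definition unit_of (E : fmod G) : ZG := [ffun g => (ecoef E g)%:Z].

End Sesqui.
End Defs.

(* Main.v *)
Require Import Defs.
From HB Require Import structures.
From mathcomp Require Import all_boot all_order all_algebra.
Set Implicit Arguments.
Unset Strict Implicit.
Unset Printing Implicit Defensive.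
Import GRing.Theory Num.Theory.
Local Open Scope ring_scope.

(* A module of finite free type over k^X is an X-graded finite-dimensional space (a complete
   family of orthogonal idempotent matrices), determined up to isomorphism by the dimensions
   of its graded pieces, also when it is presented as a quotient.  Tensoring over k^G
   multiplies these dimensions like matrices: the ((h, (k, l)), g)-piece of
   (A (x) D) (x)_{A(x)A} D has dimension \sum_m d^m_{kl} d^g_{hm}, and similarly for the
   other three modules in the axioms.  So the required isomorphisms exist exactly when the
   d^g_{hk} and e^g satisfy the associativity and unit laws of a ring with basis G, and any
   nonnegative solution is realised by modules with the prescribed dimensions. *)

Section CompleteIdempotents.
Variable k : fieldType.

Definition complete_idempotents n (X : finType) (P : X -> 'M[k]_n) :=
  (forall x y, P x *m P y = if x == y then P x else 0) /\ \sum_x P x = 1%:M.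

Lemma mulmx_idem_sub n m (P : 'M[k]_n) (B : 'M[k]_(m, n)) :
  P *m P = P -> (B <= P)%MS -> B *m P = B.
Proof. by move=> PP /submxP[D ->]; rewrite -mulmxA PP. Qed.

Variables (n : nat) (X : finType) (P : X -> 'M[k]_n).
Hypothesis cP : complete_idempotents P.

Lemma complete_idempotents_idem x : P x *m P x = P x.
Proof. by case: cP => h _; rewrite h eqxx. Qed.

Lemma complete_idempotents_orth x y : x != y -> P x *m P y = 0.
Proof. by case: cP => h _ /negPf nxy; rewrite h nxy. Qed.

Lemma mxrank_sum_complete_idempotents m (W : 'M[k]_(m, n)) :
  (forall x, W *m P x <= W)%MS -> \rank W = (\sum_x \rank (W *m P x))%N.
Proof.
move=> sW.
have dx : mxdirect (\sum_x <<W *m P x>>)%MS.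
  apply/mxdirect_sumsP => x _; apply/eqP; rewrite -submx0.
  set Z := (_ :&: _)%MS.
  have <- : Z *m P x = Z.
    apply: mulmx_idem_sub; first exact: complete_idempotents_idem.
    by apply: submx_trans (capmxSl _ _) _; rewrite genmxE submxMl.
  apply: submx_trans (submxMr (P x) (capmxSr _ _)) _.
  rewrite sumsmxMr; apply/sumsmx_subP => j /= njx.
  by rewrite (eqmxMr _ (genmxE _)) -mulmxA complete_idempotents_orth // mulmx0 sub0mx.
have -> : (W :=: \sum_x <<W *m P x>>)%MS.
  apply/eqmxP/andP; split; last by apply/sumsmx_subP => x _; rewrite genmxE sW.
  rewrite -[W in (W <= _)%MS]mulmx1; case: cP => _ <-.
  by rewrite mulmx_sumr; apply: summx_sub_sums => x _; rewrite genmxE.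
move/mxdirectP: dx => /= ->.
by apply: eq_bigr => x _; rewrite mxrank_gen.
Qed.

Lemma eq_complete_idempotents (Q : X -> 'M[k]_n) :
  P =1 Q -> complete_idempotents Q.
Proof.
move=> e; case: cP => h1 h2; split; first by move=> x y; rewrite -!e.
by rewrite -h2; apply: eq_bigr => x _; rewrite e.
Qed.

Lemma complete_idempotents_reindex (Y : finType) (g : Y -> X) :
  bijective g -> complete_idempotents (P \o g).
Proof.
case: cP => h1 h2 bg; split=> [x y|]; first by rewrite /= h1 (inj_eq (bij_inj bg)).
by rewrite -h2 (reindex g) //; apply: onW_bij.
Qed.

Definition psum (p : pred X) := \sum_(x | p x) P x.

Lemma psum_mulmx (p : pred X) x : psum p *m P x = if p x then P x else 0.
Proof.
rewrite /psum mulmx_suml; case: ifP => px.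
  rewrite (bigD1 x) //= big1 ?addr0 ?complete_idempotents_idem // => y /andP[_ nyx].
  exact: complete_idempotents_orth.
by rewrite big1 // => y py; apply: complete_idempotents_orth; apply: contraFneq px => <-.
Qed.

Lemma mulmx_psum (p : pred X) x : P x *m psum p = if p x then P x else 0.
Proof.
rewrite /psum mulmx_sumr; case: ifP => px.
  rewrite (bigD1 x) //= big1 ?addr0 ?complete_idempotents_idem // => y /andP[_ nyx].
  by apply: complete_idempotents_orth; rewrite eq_sym.
by rewrite big1 // => y py; apply: complete_idempotents_orth; apply: contraFneq px => ->.
Qed.

Lemma psumM (p q : pred X) : psum p *m psum q = psum [pred x | p x && q x].
Proof.
rewrite [X in X *m _]/psum mulmx_suml big_mkcond [RHS]big_mkcond /=.
by apply: eq_bigr => x _; rewrite mulmx_psum; case: (p x); case: (q x).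
Qed.

Lemma mxrank_psum (p : pred X) : \rank (psum p) = (\sum_(x | p x) \rank (P x))%N.
Proof.
rewrite (mxrank_sum_complete_idempotents (W := psum p)).
  rewrite [RHS]big_mkcond /=; apply: eq_bigr => x _.
  by rewrite psum_mulmx; case: (p x); rewrite ?mxrank0.
move=> x; rewrite psum_mulmx; case: ifP => px; last exact: sub0mx.
by have := mulmx_psum p x; rewrite px => <-; apply: submxMl.
Qed.

Lemma complete_idempotents_fibres (Y : finType) (h : X -> Y) :
  complete_idempotents (fun y => psum [pred x | h x == y]).
Proof.
split=> [y y'|].
  rewrite psumM; case: eqP => [<-|nyy]; first by apply: eq_bigl => x /=; rewrite andbb.
  rewrite /psum big_pred0 // => x /=.
  by apply/andP => -[/eqP e1 /eqP e2]; apply: nyy; rewrite -e1 -e2.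
by case: cP => _ <-; rewrite [RHS](partition_big h xpredT).
Qed.

End CompleteIdempotents.

Lemma complete_idempotents_delta (k : fieldType) m :
  complete_idempotents (fun i : 'I_m => (delta_mx i i : 'M[k]_m)).
Proof.
split=> [i j|]; last by rewrite -mx1_sum_delta.
by rewrite mul_delta_mx_cond; case: eqP => [->|_]; rewrite ?mulr1n ?mulr0n.
Qed.

Lemma is_fmodP (k : fieldType) (X : finType) (M : fmod k X) :
  is_fmod M <-> complete_idempotents (fop M).
Proof.
have factE f : fact M f = \sum_x f x *: fop M x by [].
have fact1 : fact M [ffun=> 1] = \sum_x fop M x.
  by apply: eq_bigr => x _; rewrite ffunE scale1r.
have fact_delta x : fact M [ffun z => (z == x)%:R] = fop M x.
  rewrite factE (bigD1 x) //= big1 ?addr0; first by rewrite ffunE eqxx scale1r.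
  by move=> y nyx; rewrite ffunE (negPf nyx) scale0r.
split=> [[hM h1]|cM].
  split=> [x y|]; last by rewrite -fact1.
  rewrite -!fact_delta -hM; case: eqVneq => [<-|nxy].
    by congr fact; apply/ffunP => z; rewrite !ffunE -natrM mulnb andbb.
  rewrite factE big1 // => z _; rewrite !ffunE -natrM mulnb.
  by case: eqVneq => [->|]; rewrite ?(negPf nxy) scale0r.
split=> [f g|]; last by case: cM => _ <-.
rewrite !factE mulmx_suml; apply: eq_bigr => x _.
rewrite ffunE -scalemxAl mulmx_sumr (bigD1 x) //= big1 ?addr0.
  by rewrite -scalemxAr complete_idempotents_idem // scalerA.
by move=> y nyx; rewrite -scalemxAr complete_idempotents_orth 1?eq_sym // scaler0.
Qed.

Section RankFacts.
Variable k : fieldType.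

Lemma kermx_coker m n (S : 'M[k]_(m, n)) : (kermx (cokermx S) :=: S)%MS.
Proof.
by apply/eqmxP/andP; split; [rewrite submxE mulmx_ker | rewrite sub_kermx mulmx_coker].
Qed.

Lemma mxrank_idem_coker n (P S : 'M[k]_n) :
  P *m P = P -> (S *m P <= S)%MS ->
  \rank (P *m cokermx S) = (\rank P - \rank (S *m P))%N.
Proof.
move=> PP sS; rewrite -(mxrank_mul_ker P (cokermx S)).
suff -> : \rank (P :&: kermx (cokermx S))%MS = \rank (S *m P) by rewrite addnK.
apply/eqmx_rank/andP; split; last by rewrite sub_capmx submxMl sub_kermx -submxE.
set Z := (_ :&: _)%MS.
have <- : Z *m P = Z by apply: mulmx_idem_sub => //; apply: capmxSl.
by rewrite submxMr // -(kermx_coker S) capmxSr.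
Qed.

Lemma mxrank_mul_eq_ker m n p p' (A : 'M[k]_(m, n)) (B : 'M[k]_(n, p)) (B' : 'M[k]_(n, p')) :
  (kermx B :=: kermx B')%MS -> \rank (A *m B) = \rank (A *m B').
Proof.
move=> eBB'; apply/eqP; rewrite -(eqn_add2r (\rank (A :&: kermx B))).
by rewrite mxrank_mul_ker (cap_eqmx (eqmx_refl A) eBB') mxrank_mul_ker.
Qed.

Lemma mxrank_unit_mull n m (C : 'M[k]_n) (T : 'M[k]_(n, m)) :
  C \in unitmx -> \rank (C *m T) = \rank T.
Proof.
move=> uC; apply/eqP; rewrite eqn_leq mxrankM_maxr /=.
by rewrite -{1}[T](mulKmx uC) mxrankM_maxr.
Qed.

End RankFacts.

Lemma sum_leq_eq (X : finType) (a b : X -> nat) :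
  (forall x, a x <= b x)%N -> (\sum_x b x <= \sum_x a x)%N -> a =1 b.
Proof.
move=> ab ba x; have := leqif_sum (fun x (_ : true) => leqif_eq (ab x)).
by move/geq_leqif; rewrite ba => /esym/forall_inP/(_ x isT)/eqP.
Qed.

Section RowSpaceIso.
Variable k : fieldType.

Definition isomx n n' (A : 'M[k]_n) (A' : 'M[k]_n') : 'M[k]_(n, n') :=
  invmx (row_ebase A) *m pid_mx (\rank A) *m row_ebase A'.

Variables (n n' : nat) (A : 'M[k]_n) (A' : 'M[k]_n').
Hypothesis rkAA' : \rank A = \rank A'.

Lemma isomx_sub : (A *m isomx A A' <= A')%MS /\ \rank (A *m isomx A A') = \rank A.
Proof.
rewrite /isomx; set r := \rank A.
have rn : (r <= n)%N by apply: rank_leq_col.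
have rn' : (r <= n')%N by rewrite /r rkAA'; apply: rank_leq_col.
set T := (pid_mx r : 'M[k]_(n, n')) *m row_ebase A'.
have -> : A *m (invmx (row_ebase A) *m pid_mx r *m row_ebase A') = col_ebase A *m T.
  rewrite -{1}(mulmx_ebase A) -!mulmxA; congr (_ *m _).
  rewrite [row_ebase A *m _]mulmxA mulmxV ?row_ebase_unit // mul1mx.
  by rewrite mulmxA mul_pid_mx minnn (minn_idPr rn).
split; last first.
  rewrite mxrank_unit_mull ?col_ebase_unit // mxrankMfree ?row_free_unit ?row_ebase_unit //.
  exact: rank_pid_mx.
have -> : T = (pid_mx r : 'M[k]_(n, n')) *m (invmx (col_ebase A') *m A').
  rewrite -{2}(mulmx_ebase A') -!mulmxA mulKmx ?col_ebase_unit // mulmxA.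
  by rewrite mul_pid_mx -rkAA' minnn (minn_idPr rn').
by rewrite !mulmxA; apply: submxMl.
Qed.

Lemma isomx_onto : (A' <= A *m isomx A A')%MS.
Proof.
have [sAA' rkA] := isomx_sub.
by have /mxrank_leqif_sup/leqifP := sAA'; rewrite rkA rkAA' ltnn; case: ifP.
Qed.

Lemma isomx_inj m (w : 'M[k]_(m, n)) : (w <= A)%MS -> w *m isomx A A' = 0 -> w = 0.
Proof.
move=> wA w0; have [_ rk] := isomx_sub.
have /eqP := mxrank_mul_ker A (isomx A A'); rewrite rk -{2}[\rank A]addn0.
rewrite eqn_add2l mxrank_eq0 => /eqP Z.
by apply/eqP; rewrite -submx0 -Z sub_capmx wA sub_kermx w0 /=.
Qed.

End RowSpaceIso.

Section GradedQuotients.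
Variable k : fieldType.

Definition graded_qmod (X : finType) (Q : qmod k X) :=
  complete_idempotents (qop Q) /\ forall x, (qsub Q *m qop Q x <= qsub Q)%MS.

Definition qrank (X : finType) (Q : qmod k X) x := \rank (qop Q x *m cokermx (qsub Q)).

Lemma sum_qrank (X : finType) (Q : qmod k X) :
  graded_qmod Q -> (\sum_x qrank Q x)%N = \rank (cokermx (qsub Q)).
Proof.
case=> cP sS; rewrite /qrank.
under eq_bigr => x _ do rewrite mxrank_idem_coker ?(complete_idempotents_idem cP) ?sS //.
rewrite sumnB; last by move=> x _; apply: mxrankM_maxr.
rewrite mxrank_coker -(mxrank_sum_complete_idempotents cP sS); congr (_ - _)%N.
transitivity (\rank (1%:M : 'M[k]_(qdim Q))); last exact: mxrank1.
rewrite (mxrank_sum_complete_idempotents cP (fun x => submx1 _)).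
by under [RHS]eq_bigr do rewrite mul1mx.
Qed.

Lemma qiso_qrank (X Y : finType) (f : X -> Y) (M : qmod k X) (N : qmod k Y) :
  graded_qmod M -> graded_qmod N -> bijective f -> qiso f M N ->
  forall x, qrank M x = qrank N (f x).
Proof.
move=> gM gN bf [F [FS FMN F_onto F_inj]].
have kerF : (kermx (F *m cokermx (qsub N)) :=: kermx (cokermx (qsub M)))%MS.
  apply: eqmx_trans (eqmx_sym (kermx_coker _)); apply/eqmxP/andP; split.
    apply/row_subP => i; apply: F_inj; rewrite -row_mul.
    by apply: submx_trans (row_sub _ _) _; rewrite submxE -mulmxA mulmx_ker.
  by rewrite sub_kermx mulmxA -submxE.
have rkF B : \rank (B *m cokermx (qsub M)) = \rank (B *m (F *m cokermx (qsub N))).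
  by apply: mxrank_mul_eq_ker; apply: eqmx_sym.
apply: sum_leq_eq => [x|].
  by rewrite /qrank rkF mulmxA FMN -mulmxA mxrankM_maxr.
have -> : (\sum_x qrank N (f x) = \sum_y qrank N y)%N.
  by rewrite [RHS](reindex f) //; apply: onW_bij.
rewrite !sum_qrank // -[cokermx (qsub M)]mul1mx rkF mul1mx mxrankS //.
rewrite -[cokermx (qsub N)]mul1mx; apply: submx_trans (submxMr _ F_onto) _.
by rewrite addsmxMr mulmx_coker addsmx0 mulmxA mulmx1.
Qed.

Lemma mxrank_diff_qsub (Z : finType) (Q : qmod k Z) z :
  graded_qmod Q -> \rank (qop Q z :\: qsub Q)%MS = qrank Q z.
Proof.
case=> cQ sQ; rewrite /qrank mxrank_idem_coker ?(complete_idempotents_idem cQ) ?sQ //.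
have capQ : (qop Q z :&: qsub Q :=: qsub Q *m qop Q z)%MS.
  apply/eqmxP/andP; split; last by rewrite sub_capmx submxMl sQ.
  rewrite -[X in (X <= _)%MS](mulmx_idem_sub (complete_idempotents_idem cQ z)) ?capmxSl //.
  by rewrite submxMr ?capmxSr.
rewrite -capQ -{1}(addsmx_diff_cap_eq (qop Q z) (qsub Q)).
rewrite mxrank_disjoint_sum ?addnK //.
by apply/eqP; rewrite -submx0 -(capmx_diff (qop Q z) (qsub Q)) capmxS ?capmxSr.
Qed.

End GradedQuotients.

Section QisoOfQrank.
Variables (k : fieldType) (X Y : finType) (f : X -> Y) (M : qmod k X) (N : qmod k Y).
Hypotheses (gM : graded_qmod M) (gN : graded_qmod N) (bf : bijective f).
Hypothesis qrankMN : forall x, qrank M x = qrank N (f x).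

Let P := qop M.
Let S := qsub M.
Let P' := qop N.
Let S' := qsub N.
Let cP : complete_idempotents P := gM.1.
Let cP' : complete_idempotents P' := gN.1.

(* The x-component of M is carried by the complement U x of V x = P x :&: S in P x;
   the isomorphism maps each U x onto U' (f x) and kills every V x. *)
Let U x := (P x :\: S)%MS.
Let V x := (P x :&: S)%MS.
Let U' y := (P' y :\: S')%MS.

Let UV0 x : (U x :&: V x = 0)%MS.
Proof. by apply/eqP; rewrite -submx0 -(capmx_diff (P x) S) capmxS ?capmxSr. Qed.

Let rkU x : \rank (U x) = \rank (U' (f x)).
Proof. by rewrite !mxrank_diff_qsub. Qed.

Definition qiso_of_qrank : 'M[k]_(qdim M, qdim N) :=
  \sum_x P x *m proj_mx (U x) (V x) *m isomx (U x) (U' (f x)) *m P' (f x).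

Let F := qiso_of_qrank.
Let T x := isomx (U x) (U' (f x)).

Let UP x : U x *m P x = U x.
Proof. by apply: mulmx_idem_sub; [exact: complete_idempotents_idem | exact: diffmxSl]. Qed.

Let UT_P' x : U x *m T x *m P' (f x) = U x *m T x.
Proof.
apply: mulmx_idem_sub; first exact: complete_idempotents_idem.
by apply: submx_trans (isomx_sub (rkU x)).1 _; apply: diffmxSl.
Qed.

Let PF x : P x *m F = P x *m proj_mx (U x) (V x) *m T x *m P' (f x).
Proof.
rewrite /F /qiso_of_qrank mulmx_sumr (bigD1 x) //= big1 ?addr0.
  by rewrite !mulmxA complete_idempotents_idem.
by move=> y nyx; rewrite !mulmxA complete_idempotents_orth 1?eq_sym // !mul0mx.
Qed.

Let FP' x : F *m P' (f x) = P x *m proj_mx (U x) (V x) *m T x *m P' (f x).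
Proof.
rewrite /F /qiso_of_qrank mulmx_suml (bigD1 x) //= big1 ?addr0.
  by rewrite -mulmxA complete_idempotents_idem.
move=> y nyx; rewrite -mulmxA complete_idempotents_orth ?mulmx0 //.
by apply: contra nyx => /eqP /(bij_inj bf) ->.
Qed.

Lemma qiso_of_qrank_qsub : S *m F = 0.
Proof.
rewrite /F /qiso_of_qrank mulmx_sumr big1 // => x _.
have SP0 : S *m P x *m proj_mx (U x) (V x) = 0.
  by apply: proj_mx_0; rewrite ?UV0 // sub_capmx submxMl gM.2.
by rewrite mulmxA [S *m _]mulmxA [S *m _]mulmxA SP0 !mul0mx.
Qed.

Lemma qiso_of_qrank_onto : (1%:M <= F + S')%MS.
Proof.
rewrite -cP'.2; apply: summx_sub => y _; have [g fgK gfK] := bf; rewrite -(gfK y).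
set x := g y.
apply: submx_trans (_ : (U' (f x) + (P' (f x) :&: S') <= _)%MS).
  by rewrite addsmx_diff_cap_eq.
rewrite addsmx_sub (submx_trans (capmxSr _ _) (addsmxSr _ _)) andbT.
apply: submx_trans (addsmxSl _ _); apply: submx_trans (isomx_onto (rkU x)) _.
have -> : U x *m T x = U x *m F.
  apply/esym; rewrite -[in LHS](UP x) -mulmxA PF.
  by rewrite [U x *m _]mulmxA [U x *m _]mulmxA [U x *m _]mulmxA UP proj_mx_id ?UV0 // UT_P'.
exact: submxMl.
Qed.

Lemma qiso_of_qrank_inj m (v : 'M[k]_(m, qdim M)) : (v *m F <= S')%MS -> (v <= S)%MS.
Proof.
move=> vF; rewrite -[v]mulmx1 -cP.2 mulmx_sumr; apply: summx_sub => x _.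
set w := v *m P x *m proj_mx (U x) (V x).
have wU : (w <= U x)%MS by apply: proj_mx_sub.
suff w0 : w = 0.
  have : (v *m P x - w <= V x)%MS.
    by apply: proj_mx_compl_sub; rewrite addsmx_diff_cap_eq submxMl.
  by rewrite w0 subr0 => /submx_trans; apply; apply: capmxSr.
apply: (isomx_inj (rkU x) wU); apply/eqP; rewrite -submx0.
rewrite -(capmx_diff (P' (f x)) S') sub_capmx.
have wT : (w *m T x <= U' (f x))%MS.
  exact: submx_trans (submxMr _ wU) (isomx_sub (rkU x)).1.
apply/andP; split=> //.
have -> : w *m T x = v *m F *m P' (f x).
  rewrite -mulmxA FP' [v *m _]mulmxA [v *m _]mulmxA [v *m _]mulmxA -/w.
  by rewrite [RHS]mulmx_idem_sub ?complete_idempotents_idem // (submx_trans wT (diffmxSl _ _)).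
by apply: submx_trans (submxMr _ vF) (gN.2 _).
Qed.

Lemma qrank_qiso : qiso f M N.
Proof.
exists F; split; last exact: qiso_of_qrank_inj; last exact: qiso_of_qrank_onto.
  by rewrite qiso_of_qrank_qsub sub0mx.
by move=> x; rewrite PF FP'.
Qed.

End QisoOfQrank.

Section Kronecker.
Variable k : fieldType.

Lemma tensmx_suml m n p q (I : finType) (r : pred I) (A : I -> 'M[k]_(m, n)) (B : 'M[k]_(p, q)) :
  (\sum_(i | r i) A i) *t B = \sum_(i | r i) (A i *t B).
Proof.
by apply/matrixP => i j; rewrite mxE !summxE mulr_suml; apply: eq_bigr => c _; rewrite mxE.
Qed.

Lemma tensmx_sumr m n p q (I : finType) (r : pred I) (A : 'M[k]_(m, n)) (B : I -> 'M[k]_(p, q)) :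
  A *t (\sum_(i | r i) B i) = \sum_(i | r i) (A *t B i).
Proof.
by apply/matrixP => i j; rewrite mxE !summxE mulr_sumr; apply: eq_bigr => c _; rewrite mxE.
Qed.

Lemma tensmx11 m n : (1%:M : 'M[k]_m) *t (1%:M : 'M[k]_n) = 1%:M.
Proof.
apply/matrixP => i j; case: (mxtens_indexP i) => i1 i2; case: (mxtens_indexP j) => j1 j2.
rewrite tensmxE !mxE (inj_eq (can_inj (@mxtens_indexK _ _))) xpair_eqE.
by rewrite -natrM mulnb.
Qed.

Lemma tensmx_delta m n (i : 'I_m) (j : 'I_n) :
  (delta_mx i i : 'M[k]_m) *t (delta_mx j j : 'M[k]_n) =
  delta_mx (mxtens_index (i, j)) (mxtens_index (i, j)).
Proof.
apply/matrixP => a b; case: (mxtens_indexP a) => a1 a2; case: (mxtens_indexP b) => b1 b2.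
rewrite tensmxE !mxE !(inj_eq (can_inj (@mxtens_indexK _ _))) !xpair_eqE.
by rewrite -natrM mulnb; case: (a1 == i); case: (a2 == j); case: (b1 == i); case: (b2 == j).
Qed.

Variables (m n : nat) (X Y : finType) (P : X -> 'M[k]_m) (Q : Y -> 'M[k]_n).

Lemma tensmx_psum (p : pred X) (q : pred Y) :
  psum P p *t psum Q q = psum (fun c : X * Y => P c.1 *t Q c.2) [pred c | p c.1 && q c.2].
Proof.
rewrite /psum tensmx_suml; under eq_bigr => a _ do rewrite tensmx_sumr.
by rewrite pair_big_dep.
Qed.

Lemma complete_idempotents_tens :
  complete_idempotents P -> complete_idempotents Q ->
  complete_idempotents (fun c : X * Y => P c.1 *t Q c.2).
Proof.
move=> [hP sP] [hQ sQ]; split=> [[x y] [x' y']|] /=.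
  rewrite tensmx_mul hP hQ xpair_eqE.
  by case: (x == x'); case: (y == y'); rewrite ?tens0mx ?tensmx0.
have := tensmx_psum xpredT xpredT; rewrite /psum sP sQ tensmx11 => ->.
by apply: eq_bigl => c.
Qed.

End Kronecker.

Lemma pid_mx_psum (k : fieldType) m r :
  (pid_mx r : 'M[k]_m) = psum (fun i : 'I_m => delta_mx i i) [pred i : 'I_m | (i < r)%N].
Proof.
apply/matrixP => i j; rewrite summxE !mxE.
case: (boolP (i < r)%N) => ir.
  rewrite (bigD1 i) //= mxE eqxx /= big1 ?addr0; first by rewrite andbT val_eqE eq_sym.
  by move=> l /andP[_ nli]; rewrite mxE eq_sym (negPf nli).
rewrite andbF big1 // => l /= lr; rewrite mxE.
by case: eqVneq => [eil|] //; move: ir; rewrite eil lr.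
Qed.

Lemma sum1_ord_lt m r : (r <= m)%N -> (\sum_(i < m | (i < r)%N) 1)%N = r.
Proof.
move=> rm; rewrite -(big_mkord (fun i => i < r)%N (fun=> 1%N)) -(big_nat_widen 0 r m xpredT) //.
by rewrite sum_nat_const_nat muln1 subn0.
Qed.

Section KroneckerRank.
Variable k : fieldType.

Lemma mxrank_tens_pid m n r s : (r <= m)%N -> (s <= n)%N ->
  \rank ((pid_mx r : 'M[k]_m) *t (pid_mx s : 'M[k]_n)) = (r * s)%N.
Proof.
move=> rm sn; rewrite !pid_mx_psum tensmx_psum.
rewrite mxrank_psum; last exact: complete_idempotents_tens (complete_idempotents_delta k m)
  (complete_idempotents_delta k n).
under eq_bigr => c _ do rewrite tensmx_delta mxrank_delta.
rewrite -(pair_big_dep (fun i : 'I_m => (i < r)%N) (fun _ (j : 'I_n) => (j < s)%N)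
                       (fun _ _ => 1%N)) /=.
under eq_bigr => i _ do rewrite sum1_ord_lt //.
by rewrite -[s]mul1n -big_distrl /= sum1_ord_lt // mul1n.
Qed.

Lemma mxrank_tens m n (A : 'M[k]_m) (B : 'M[k]_n) :
  \rank (A *t B) = (\rank A * \rank B)%N.
Proof.
case: m A => [|m] A.
  by have := rank_leq_row (A *t B); rewrite leqn0 [A]flatmx0 mxrank0 => /eqP.
case: n B => [|n] B.
  have := rank_leq_row (A *t B); rewrite [X in (_ <= X)%N]muln0 leqn0 => /eqP ->.
  by rewrite [B]flatmx0 mxrank0 muln0.
rewrite -{1}(mulmx_ebase A) -{1}(mulmx_ebase B) -!tensmx_mul -mulmxA.
rewrite mxrank_unit_mull; last by apply: tensmx_unit; rewrite ?col_ebase_unit.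
rewrite mxrankMfree; last by rewrite row_free_unit tensmx_unit ?row_ebase_unit.
by rewrite mxrank_tens_pid ?rank_leq_row.
Qed.

End KroneckerRank.

Lemma sum_pair_fst (V : nmodType) (A B : finType) x (F : A * B -> V) :
  \sum_(b : B) F (x, b) = \sum_(c | c.1 == x) F c.
Proof.
transitivity (\sum_(a | a == x) \sum_(b : B) F (a, b)); first by rewrite (big_pred1 x).
by rewrite pair_big_dep; apply: eq_big => [c|c _]; rewrite ?andbT -?surjective_pairing.
Qed.

Lemma sum_pair_snd (V : nmodType) (A B : finType) y (F : A * B -> V) :
  \sum_(a : A) F (a, y) = \sum_(c | c.2 == y) F c.
Proof.
transitivity (\sum_(a : A) \sum_(b | b == y) F (a, b)).
  by apply: eq_bigr => a _; rewrite (big_pred1 y).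
by rewrite pair_big_dep; apply: eq_bigr => c _; rewrite -surjective_pairing.
Qed.

Lemma sum_chain (L Mi R : finType) (a : L * Mi -> nat) (b : Mi * R -> nat) x z :
  (\sum_(c : (L * Mi) * (Mi * R) | ((c.1.1, c.2.2) == (x, z)) && (c.1.2 == c.2.1))
     a c.1 * b c.2)%N = (\sum_y a (x, y) * b (y, z))%N.
Proof.
rewrite (eq_bigl (fun c => (c.1.1 == x) && ((c.2.2 == z) && (c.1.2 == c.2.1)))); last first.
  by move=> c; rewrite xpair_eqE andbA.
transitivity (\sum_(u : L * Mi | u.1 == x)
    \sum_(v : Mi * R | (v.2 == z) && (u.2 == v.1)) a u * b v)%N; first by rewrite pair_big_dep.
rewrite [RHS](sum_pair_fst x (fun u => a u * b (u.2, z))%N); apply: eq_bigr => u _.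
rewrite (big_pred1 (u.2, z)) // => -[v1 v2] /=.
by rewrite xpair_eqE andbC eq_sym.
Qed.

Section TensOver.
Variables (k : fieldType) (L Mi R : finType).
Variables (M : fmod k (L * Mi)%type) (N : fmod k (Mi * R)%type).
Hypotheses (cM : complete_idempotents (fop M)) (cN : complete_idempotents (fop N)).

(* M (x)_k N is graded by (L * Mi) * (Mi * R); the quotient kills the components off the
   diagonal c.1.2 = c.2.1 and keeps the diagonal ones. *)
Let Pi (c : (L * Mi) * (Mi * R)) := fop M c.1 *t fop N c.2.
Let cPi : complete_idempotents Pi := complete_idempotents_tens cM cN.
Let fibre w := [pred c : (L * Mi) * (Mi * R) | (c.1.1, c.2.2) == w].
Let S := qsub (tens_over M N).

Lemma tens_over_qop w : qop (tens_over M N) w = psum Pi (fibre w).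
Proof.
case: w => x z; rewrite /= /lact /ract sum_pair_fst sum_pair_snd tensmx_psum.
by apply: eq_bigl => c; rewrite /= xpair_eqE.
Qed.

Lemma tens_over_relE y :
  ract M y *t 1%:M - 1%:M *t lact N y =
  psum Pi [pred c | c.1.2 == y] - psum Pi [pred c | c.2.1 == y].
Proof.
rewrite /ract /lact -{1}cN.2 -{1}cM.2 sum_pair_snd sum_pair_fst.
rewrite -[X in _ *t X - _](big_filter _ xpredT) -[X in _ - X *t _](big_filter _ xpredT).
by rewrite !big_filter !tensmx_psum; congr (_ - _); apply: eq_bigl => c /=; rewrite ?andbT.
Qed.

Let rel_coef y (c : (L * Mi) * (Mi * R)) : k := (c.1.2 == y)%:R - (c.2.1 == y)%:R.

Let if_subE n (A : 'M[k]_n) (b b' : bool) :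
  (if b then A else 0) - (if b' then A else 0) = (b%:R - b'%:R : k) *: A.
Proof. by case: b; case: b'; rewrite ?subrr ?scale0r ?subr0 ?scale1r ?sub0r ?scaleN1r. Qed.

Lemma tens_over_rel_mulmx y c :
  (ract M y *t 1%:M - 1%:M *t lact N y) *m Pi c = rel_coef y c *: Pi c
  /\ Pi c *m (ract M y *t 1%:M - 1%:M *t lact N y) = rel_coef y c *: Pi c.
Proof. by rewrite tens_over_relE mulmxBl mulmxBr !psum_mulmx ?mulmx_psum //= !if_subE. Qed.

Lemma mxrank_qsub_tens_over_mulmx c :
  \rank (S *m Pi c) = if c.1.2 == c.2.1 then 0%N else \rank (Pi c).
Proof.
rewrite /S /= sumsmxMr; under eq_bigr => y _ do rewrite (tens_over_rel_mulmx y c).1.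
case: eqP => [E|/eqP E].
  by rewrite big1 ?mxrank0 // => y _; rewrite /rel_coef E subrr scale0r.
apply/eqmx_rank/andP; split; first by apply/sumsmx_subP => y _; apply: scalemx_sub.
apply: (sumsmx_sup c.1.2) => //.
by rewrite /rel_coef eqxx eq_sym (negPf E) subr0 scale1r.
Qed.

Lemma qsub_tens_over_stable (B : 'M[k]_(fdim M * fdim N)) :
  (forall y, (ract M y *t 1%:M - 1%:M *t lact N y) *m B =
             B *m (ract M y *t 1%:M - 1%:M *t lact N y)) ->
  (S *m B <= S)%MS.
Proof.
move=> relB; rewrite /S /= sumsmxMr; apply/sumsmx_subP => y _; rewrite relB.
by apply: submx_trans (submxMl _ _) _; apply: (sumsmx_sup y).
Qed.

Lemma qsub_tens_over_mulmx_sub c : (S *m Pi c <= S)%MS.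
Proof.
apply: qsub_tens_over_stable => y.
by rewrite (tens_over_rel_mulmx y c).1 (tens_over_rel_mulmx y c).2.
Qed.

Lemma graded_tens_over : graded_qmod (tens_over M N).
Proof.
split.
  apply: (eq_complete_idempotents (complete_idempotents_fibres cPi (fun c => (c.1.1, c.2.2)))).
  by move=> w; rewrite tens_over_qop.
move=> w; rewrite tens_over_qop; apply: qsub_tens_over_stable => y.
rewrite tens_over_relE mulmxBl mulmxBr !psumM //.
by congr (_ - _); apply: eq_bigl => c; rewrite /= andbC.
Qed.

Lemma qrank_tens_over x z :
  qrank (tens_over M N) (x, z) = (\sum_y \rank (fop M (x, y)) * \rank (fop N (y, z)))%N.
Proof.
have cQ := (graded_tens_over).1; have sQ := (graded_tens_over).2.
rewrite /qrank mxrank_idem_coker ?(complete_idempotents_idem cQ) ?sQ //.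
rewrite tens_over_qop mxrank_psum //.
have SQ_stable c : (S *m psum Pi (fibre (x, z)) *m Pi c <= S *m psum Pi (fibre (x, z)))%MS.
  rewrite -mulmxA psum_mulmx //; case: ifP => hc; last by rewrite mulmx0 sub0mx.
  have := mulmx_psum cPi (fibre (x, z)) c; rewrite hc => <-.
  by rewrite mulmxA submxMr ?qsub_tens_over_mulmx_sub.
rewrite (mxrank_sum_complete_idempotents cPi SQ_stable).
have rkSQ c : \rank (S *m psum Pi (fibre (x, z)) *m Pi c) =
    if fibre (x, z) c && (c.1.2 != c.2.1) then \rank (Pi c) else 0%N.
  rewrite -mulmxA psum_mulmx //; case: (fibre (x, z) c); last by rewrite mulmx0 mxrank0.
  by rewrite mxrank_qsub_tens_over_mulmx; case: (c.1.2 == c.2.1).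
under [X in (_ - X)%N]eq_bigr => c _ do rewrite rkSQ.
rewrite -big_mkcond (bigID (fun c => c.1.2 == c.2.1)) /=.
rewrite addnK.
rewrite -(sum_chain (fun a => \rank (fop M a)) (fun b => \rank (fop N b))).
by apply: eq_big => c; rewrite ?mxrank_tens // andbC.
Qed.

End TensOver.

Section Modules.
Variable k : fieldType.

Lemma complete_idempotents_etens (L1 R1 L2 R2 : finType)
    (M : fmod k (L1 * R1)%type) (N : fmod k (L2 * R2)%type) :
  complete_idempotents (fop M) -> complete_idempotents (fop N) ->
  complete_idempotents (fop (etens M N)).
Proof.
move=> cM cN; pose swap (x : (L1 * L2) * (R1 * R2)) := ((x.1.1, x.2.1), (x.1.2, x.2.2)).
apply: (complete_idempotents_reindex (g := swap) (complete_idempotents_tens cM cN)).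
by exists (fun y : (L1 * R1) * (L2 * R2) => ((y.1.1, y.2.1), (y.1.2, y.2.2)));
  case=> [[a b] [c d]].
Qed.

Lemma mxrank_etens (L1 R1 L2 R2 : finType) (M : fmod k (L1 * R1)%type)
    (N : fmod k (L2 * R2)%type) x :
  \rank (fop (etens M N) x) = (\rank (fop M (x.1.1, x.2.1)) * \rank (fop N (x.1.2, x.2.2)))%N.
Proof. exact: mxrank_tens. Qed.

Lemma complete_idempotents_regA (G : finType) : complete_idempotents (fop (regA k G)).
Proof.
apply: (eq_complete_idempotents (complete_idempotents_fibres (complete_idempotents_delta k #|G|)
                                   (fun j => (enum_val j, enum_val j)))).
case=> a b /=; rewrite /psum; case: eqVneq => [<-|nab].
  rewrite (big_pred1 (enum_rank a)) // => j /=.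
  by rewrite xpair_eqE andbb; apply/eqP/eqP => [<-|->]; rewrite ?enum_valK ?enum_rankK.
rewrite big_pred0 // => j /=; rewrite xpair_eqE.
by apply/andP => -[/eqP ea /eqP eb]; move: nab; rewrite -ea -eb eqxx.
Qed.

Lemma mxrank_regA (G : finType) (a b : G) : \rank (fop (regA k G) (a, b)) = (a == b) :> nat.
Proof. by rewrite /=; case: (a == b); rewrite ?mxrank_delta ?mxrank0. Qed.

Lemma complete_idempotents_as_right (G : finType) (E : fmod k G) :
  complete_idempotents (fop E) -> complete_idempotents (fop (as_right E)).
Proof.
move=> cE; apply: (complete_idempotents_reindex (g := fun x : unit * G => x.2) cE).
by exists (fun g => (tt, g)) => // -[[] g].
Qed.

Lemma graded_qmod_of (X : finType) (M : fmod k X) :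
  complete_idempotents (fop M) -> graded_qmod (qmod_of M).
Proof. by split=> // x; rewrite /= mul0mx sub0mx. Qed.

Lemma qrank_qmod_of (X : finType) (M : fmod k X) x :
  complete_idempotents (fop M) -> qrank (qmod_of M) x = \rank (fop M x).
Proof.
move=> cM; rewrite /qrank mxrank_idem_coker ?(complete_idempotents_idem cM) //=.
  by rewrite mul0mx mxrank0 subn0.
by rewrite mul0mx sub0mx.
Qed.

End Modules.

Definition mult_seq (X : finType) (r : X -> nat) := flatten [seq nseq (r x) x | x <- enum X].

Lemma count_mult_seq (X : finType) (r : X -> nat) x : count_mem x (mult_seq r) = r x.
Proof.
rewrite /mult_seq count_flatten -map_comp sumnE big_map big_enum /=.
rewrite (bigD1 x) //= count_nseq /= eqxx mul1n big1 ?addn0 // => y nyx.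
by rewrite count_nseq /= (negPf nyx).
Qed.

Section FmodOfRank.
Variables (k : fieldType) (X : finType) (r : X -> nat).

(* The x-component is spanned by the coordinates j whose label (mult_seq r)_j is x. *)
Definition fmod_of_rank : fmod k X :=
  @FMod k X (size (mult_seq r))
    (fun x => psum (fun j : 'I_(size (mult_seq r)) => delta_mx j j)
                   [pred j | tnth (in_tuple (mult_seq r)) j == x]).

Lemma complete_idempotents_fmod_of_rank : complete_idempotents (fop fmod_of_rank).
Proof. exact: (complete_idempotents_fibres (complete_idempotents_delta k _)). Qed.

Lemma mxrank_fmod_of_rank x : \rank (fop fmod_of_rank x) = r x.
Proof.
rewrite /= mxrank_psum; last exact: complete_idempotents_delta.
under eq_bigr => j _ do rewrite mxrank_delta.
by rewrite -(big_tnth _ _ _ (fun y : X => y == x) (fun _ => 1%N)) sum1_count count_mult_seq.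
Qed.

End FmodOfRank.

Lemma qiso_qmod_ofP (k : fieldType) (X : finType) (M N : fmod k X) :
  complete_idempotents (fop M) -> complete_idempotents (fop N) ->
  qiso id (qmod_of M) (qmod_of N) <-> forall x, \rank (fop M x) = \rank (fop N x).
Proof.
move=> cM cN; have idK : bijective (@id X) by exists id.
split=> [/(qiso_qrank (graded_qmod_of cM) (graded_qmod_of cN) idK) e x | e].
  by have := e x; rewrite !qrank_qmod_of.
by apply: qrank_qiso (graded_qmod_of cM) (graded_qmod_of cN) idK _ => x; rewrite !qrank_qmod_of.
Qed.

Lemma sum_pair_indicator_fst (A B : finType) (a : A) (F : A * B -> nat) :
  (\sum_(c : A * B) (a == c.1) * F c = \sum_b F (a, b))%N.
Proof.
rewrite sum_pair_fst [RHS]big_mkcond; apply: eq_bigr => c _.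
by rewrite eq_sym; case: (c.1 == a); rewrite ?mul1n ?mul0n.
Qed.

Lemma sum_pair_indicator_snd (A B : finType) (b : B) (F : A * B -> nat) :
  (\sum_(c : A * B) F c * (b == c.2) = \sum_a F (a, b))%N.
Proof.
rewrite sum_pair_snd [RHS]big_mkcond; apply: eq_bigr => c _.
by rewrite eq_sym; case: (c.2 == b); rewrite ?muln1 ?muln0.
Qed.

Section SesquiRanks.
Variables (k : fieldType) (G : finType).
Variables (D : fmod k ((G * G) * G)%type) (E : fmod k G).
Hypotheses (cD : complete_idempotents (fop D)) (cE : complete_idempotents (fop E)).

Let cA := complete_idempotents_regA k G.
Let cE' := complete_idempotents_as_right cE.

Lemma qrank_assoc_lhs h k0 l g :
  qrank (tens_over (etens (regA k G) D) D) ((h, (k0, l)), g) =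
  (\sum_m dcoef D k0 l m * dcoef D h m g)%N.
Proof.
rewrite (qrank_tens_over (complete_idempotents_etens cA cD) cD).
under eq_bigr => y _ do rewrite mxrank_etens /= mxrank_regA -mulnA.
exact: (sum_pair_indicator_fst h (fun y => dcoef D k0 l y.2 * \rank (fop D (y, g))))%N.
Qed.

Lemma qrank_assoc_rhs h k0 l g :
  qrank (tens_over (etens D (regA k G)) D) (((h, k0), l), g) =
  (\sum_m dcoef D h k0 m * dcoef D m l g)%N.
Proof.
rewrite (qrank_tens_over (complete_idempotents_etens cD cA) cD).
under eq_bigr => y _ do rewrite mxrank_etens /= mxrank_regA mulnAC.
exact: (sum_pair_indicator_snd l (fun y => dcoef D h k0 y.1 * \rank (fop D (y, g))))%N.
Qed.

Lemma qrank_lunit k0 g :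
  qrank (tens_over (etens (as_right E) (regA k G)) D) ((tt, k0), g) =
  (\sum_a ecoef E a * dcoef D a k0 g)%N.
Proof.
rewrite (qrank_tens_over (complete_idempotents_etens cE' cA) cD).
under eq_bigr => y _ do rewrite mxrank_etens /= mxrank_regA mulnAC.
exact: (sum_pair_indicator_snd k0 (fun y => ecoef E y.1 * \rank (fop D (y, g))))%N.
Qed.

Lemma qrank_runit h g :
  qrank (tens_over (etens (regA k G) (as_right E)) D) ((h, tt), g) =
  (\sum_b ecoef E b * dcoef D h b g)%N.
Proof.
rewrite (qrank_tens_over (complete_idempotents_etens cA cE') cD).
under eq_bigr => y _ do rewrite mxrank_etens /= mxrank_regA -mulnA.
exact: (sum_pair_indicator_fst h (fun y => ecoef E y.2 * \rank (fop D (y, g))))%N.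
Qed.

End SesquiRanks.

(* The ring axioms of Z^G written on the structure constants d^g_{hk} and e^g. *)
Definition unital_assoc_consts (G : finType) (d : G -> G -> G -> nat) (e : G -> nat) :=
  [/\ forall h k l g, (\sum_m d k l m * d h m g = \sum_m d h k m * d m l g)%N,
      forall k g, (\sum_a e a * d a k g)%N = (k == g) :> nat
    & forall h g, (\sum_b e b * d h b g)%N = (h == g) :> nat].

Section IndexBijections.
Variable G : finType.

Lemma assoc_idx_bij : bijective (@assoc_idx G).
Proof.
exists (fun x : ((G * G) * G) * G => ((x.1.1.1, (x.1.1.2, x.1.2)), x.2)).
  by case=> [[a [b c]] d].
by case=> [[[a b] c] d].
Qed.

Lemma lunit_idx_bij : bijective (@lunit_idx G).
Proof. by exists (fun x : G * G => ((tt, x.1), x.2)); [case=> [[[] a] b] | case]. Qed.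

Lemma runit_idx_bij : bijective (@runit_idx G).
Proof. by exists (fun x : G * G => ((x.1, tt), x.2)); [case=> [[a []] b] | case]. Qed.

End IndexBijections.

Lemma sesquialgebraP (k : fieldType) (G : finType)
    (D : fmod k ((G * G) * G)%type) (E : fmod k G) :
  sesquialgebra D E <->
  [/\ is_fmod D, is_fmod E & unital_assoc_consts (dcoef D) (ecoef E)].
Proof.
suff qisosP (cD : complete_idempotents (fop D)) (cE : complete_idempotents (fop E)) :
    [/\ qiso (@assoc_idx G) (tens_over (etens (regA k G) D) D) (tens_over (etens D (regA k G)) D),
        qiso (@lunit_idx G) (tens_over (etens (as_right E) (regA k G)) D) (qmod_of (regA k G))
      & qiso (@runit_idx G) (tens_over (etens (regA k G) (as_right E)) D) (qmod_of (regA k G))]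
    <-> unital_assoc_consts (dcoef D) (ecoef E).
  split=> [[iD iE hA hL hR]|[iD iE hD]].
    by split=> //; apply/(qisosP ((is_fmodP D).1 iD) ((is_fmodP E).1 iE)).
  by have [] := (qisosP ((is_fmodP D).1 iD) ((is_fmodP E).1 iE)).2 hD.
have cA := complete_idempotents_regA k G; have cE' := complete_idempotents_as_right cE.
have gA1 := graded_tens_over (complete_idempotents_etens cA cD) cD.
have gA2 := graded_tens_over (complete_idempotents_etens cD cA) cD.
have gL := graded_tens_over (complete_idempotents_etens cE' cA) cD.
have gR := graded_tens_over (complete_idempotents_etens cA cE') cD.
have gA := graded_qmod_of cA.
have rkA a b : qrank (qmod_of (regA k G)) (a, b) = (a == b) :> nat.
  by rewrite qrank_qmod_of // mxrank_regA.
split=> [[hA hL hR]|[hA hL hR]]; split.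
- move=> h k0 l g; have := qiso_qrank gA1 gA2 (assoc_idx_bij G) hA ((h, (k0, l)), g).
  by rewrite qrank_assoc_lhs // qrank_assoc_rhs.
- move=> k0 g; have := qiso_qrank gL gA (lunit_idx_bij G) hL ((tt, k0), g).
  by rewrite qrank_lunit // rkA.
- move=> h g; have := qiso_qrank gR gA (runit_idx_bij G) hR ((h, tt), g).
  by rewrite qrank_runit // rkA.
- apply: qrank_qiso gA1 gA2 (assoc_idx_bij G) _ => -[[h [k0 l]] g].
  by rewrite qrank_assoc_lhs // qrank_assoc_rhs.
- apply: qrank_qiso gL gA (lunit_idx_bij G) _ => -[[[] k0] g].
  by rewrite qrank_lunit // rkA.
- apply: qrank_qiso gR gA (runit_idx_bij G) _ => -[[h []] g].
  by rewrite qrank_runit // rkA.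
Qed.

Lemma eq_unital_assoc_consts (G : finType) (d d' : G -> G -> G -> nat) (e e' : G -> nat) :
  (forall h k g, d h k g = d' h k g) -> e =1 e' ->
  unital_assoc_consts d e -> unital_assoc_consts d' e'.
Proof.
move=> ed ee [dA dL dR]; split=> *.
- by under eq_bigr do rewrite -!ed; under [RHS]eq_bigr do rewrite -!ed.
- by under eq_bigr do rewrite -ed -ee.
- by under eq_bigr do rewrite -ed -ee.
Qed.

Section ConstantRing.
Variables (G : finType) (d : G -> G -> G -> nat) (e : G -> nat).

Definition mul_const (a b : ZG G) : ZG G :=
  [ffun g => \sum_(h : G) \sum_(k : G) a h * b k * (d h k g)%:Z].
Definition unit_const : ZG G := [ffun g => (e g)%:Z].

Lemma PoszM_sum (I : finType) (F1 F2 : I -> nat) :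
  ((\sum_i F1 i * F2 i)%N)%:Z = \sum_i (F1 i)%:Z * (F2 i)%:Z.
Proof. by rewrite (big_morph Posz PoszD (erefl 0%:Z)); under eq_bigr do rewrite PoszM. Qed.

Lemma mul_const_gbasisl h b g : mul_const (gbasis h) b g = \sum_k b k * (d h k g)%:Z.
Proof.
rewrite ffunE (bigD1 h) //= [X in _ + X]big1 ?addr0.
  by apply: eq_bigr => k _; rewrite ffunE eqxx mul1r.
by move=> x nxh; apply: big1 => y _; rewrite ffunE (negPf nxh) !mul0r.
Qed.

Lemma mul_const_gbasisr a l g : mul_const a (gbasis l) g = \sum_h a h * (d h l g)%:Z.
Proof.
rewrite ffunE; apply: eq_bigr => h _; rewrite (bigD1 l) //= big1 ?addr0.
  by rewrite ffunE eqxx mulr1.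
by move=> y nyl; rewrite ffunE (negPf nyl) mulr0 mul0r.
Qed.

Lemma mul_const_gbasis h l g : mul_const (gbasis h) (gbasis l) g = (d h l g)%:Z.
Proof.
rewrite mul_const_gbasisr (bigD1 h) //= big1 ?addr0; first by rewrite ffunE eqxx mul1r.
by move=> x nxh; rewrite ffunE (negPf nxh) mul0r.
Qed.

Lemma mul_const_gbasisA h k l g :
  mul_const (mul_const (gbasis h) (gbasis k)) (gbasis l) g =
    ((\sum_m d h k m * d m l g)%N)%:Z
  /\ mul_const (gbasis h) (mul_const (gbasis k) (gbasis l)) g =
    ((\sum_m d k l m * d h m g)%N)%:Z.
Proof.
rewrite mul_const_gbasisr mul_const_gbasisl !PoszM_sum.
by split; apply: eq_bigr => m _; rewrite mul_const_gbasis.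
Qed.

Lemma mul_const_unitl k g : mul_const unit_const (gbasis k) g = ((\sum_a e a * d a k g)%N)%:Z.
Proof. by rewrite mul_const_gbasisr PoszM_sum; apply: eq_bigr => a _; rewrite ffunE. Qed.

Lemma mul_const_unitr h g : mul_const (gbasis h) unit_const g = ((\sum_b e b * d h b g)%N)%:Z.
Proof. by rewrite mul_const_gbasisl PoszM_sum; apply: eq_bigr => b _; rewrite ffunE. Qed.

End ConstantRing.

Section AdditiveExt.
Variable G : finType.

Lemma ZG_decomp (a : ZG G) : a = \sum_h gbasis h *~ a h.
Proof.
apply/ffunP => g; rewrite sum_ffunE (bigD1 g) //= big1 ?addr0.
  by rewrite ffunMzE ffunE eqxx mulrzz mul1r.
by move=> h nhg; rewrite ffunMzE ffunE eq_sym (negPf nhg) mulrzz mul0r.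
Qed.

Lemma ZG_additive_ext (f f' : ZG G -> ZG G) :
  {morph f : x y / x + y} -> {morph f' : x y / x + y} ->
  (forall h, f (gbasis h) = f' (gbasis h)) -> f =1 f'.
Proof.
move=> fD f'D ef a.
have expand (phi : ZG G -> ZG G) : {morph phi : x y / x + y} ->
    phi a = \sum_h phi (gbasis h) *~ a h.
  move=> phiD; have phiB : {morph phi : x y / x - y}.
    by move=> x y; apply: (addIr (phi y)); rewrite -phiD !subrK.
  pose phiA : {additive ZG G -> ZG G} := HB.pack phi (GRing.isZmodMorphism.Build _ _ phi phiB).
  transitivity (phiA a); first by [].
  by rewrite {1}[a]ZG_decomp raddf_sum; apply: eq_bigr => h _; rewrite raddfMz.
by rewrite !expand //; under eq_bigr do rewrite ef.
Qed.

End AdditiveExt.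

Section ConstantRingLaws.
Variables (G : finType) (d : G -> G -> G -> nat) (e : G -> nat).
Local Notation mul := (mul_const d).

Lemma mul_constDl a b c : mul (a + b) c = mul a c + mul b c.
Proof.
apply/ffunP => g; rewrite !ffunE -big_split; apply: eq_bigr => h _.
by rewrite -big_split; apply: eq_bigr => k _; rewrite ffunE !mulrDl.
Qed.

Lemma mul_constDr a b c : mul a (b + c) = mul a b + mul a c.
Proof.
apply/ffunP => g; rewrite !ffunE -big_split; apply: eq_bigr => h _.
by rewrite -big_split; apply: eq_bigr => k _; rewrite ffunE mulrDr !mulrDl.
Qed.

Lemma unital_ring_mul_const : unital_assoc_consts d e -> unital_ring_on mul (unit_const e).
Proof.
case=> dA dL dR; split=> [||a b c|a|a]; [exact: mul_constDl | exact: mul_constDr | | |].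
- apply: (ZG_additive_ext (f := fun a => mul (mul a b) c) (f' := fun a => mul a (mul b c)))
    => [x y|x y|h] /=; rewrite ?mul_constDl //.
  apply: (ZG_additive_ext (f := fun b => mul (mul (gbasis h) b) c)
                          (f' := fun b => mul (gbasis h) (mul b c)))
    => [x y|x y|k] /=; rewrite ?mul_constDr ?mul_constDl ?mul_constDr //.
  apply: (ZG_additive_ext (f := fun c => mul (mul (gbasis h) (gbasis k)) c)
                          (f' := fun c => mul (gbasis h) (mul (gbasis k) c)))
    => [x y|x y|l] /=; rewrite ?mul_constDr //.
  by apply/ffunP => g; have [-> ->] := mul_const_gbasisA d h k l g; rewrite dA.
- apply: (ZG_additive_ext (f := mul (unit_const e)) (f' := id)) => [x y|x y|k] //=.
    exact: mul_constDr.
  by apply/ffunP => g; rewrite mul_const_unitl dL ffunE eq_sym.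
- apply: (ZG_additive_ext (f := mul^~ (unit_const e)) (f' := id)) => [x y|x y|h] //=.
    exact: mul_constDl.
  by apply/ffunP => g; rewrite mul_const_unitr dR ffunE eq_sym.
Qed.

Lemma unital_assoc_consts_of_ring :
  unital_ring_on mul (unit_const e) -> unital_assoc_consts d e.
Proof.
case=> _ _ mulA mul1 mulr1; split=> [h k l g|k g|h g]; apply/eqP; rewrite -eqz_nat; apply/eqP.
- by have [<- <-] := mul_const_gbasisA d h k l g; rewrite mulA.
- by rewrite -mul_const_unitl mul1 ffunE eq_sym.
- by rewrite -mul_const_unitr mulr1 ffunE eq_sym.
Qed.

End ConstantRingLaws.

Lemma nonneg_consts_mul_const (G : finType) (d : G -> G -> G -> nat) (e : G -> nat) :
  nonneg_consts (mul_const d) (unit_const e).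
Proof. by split=> [h k g|g]; rewrite ?mul_const_gbasis ?ffunE. Qed.

Lemma eq_unital_ring_on (G : finType) (mul mul' : ZG G -> ZG G -> ZG G) (e : ZG G) :
  mul =2 mul' -> unital_ring_on mul e -> unital_ring_on mul' e.
Proof. by move=> emul [mDl mDr mA m1 mr1]; split=> *; rewrite -?emul. Qed.

Section NonnegRing.
Variables (G : finType) (mul : ZG G -> ZG G -> ZG G) (e : ZG G).
Hypotheses (mulDl : forall a b c, mul (a + b) c = mul a c + mul b c)
           (mulDr : forall a b c, mul a (b + c) = mul a b + mul a c)
           (nn : nonneg_consts mul e).

Definition abs_consts (h k g : G) : nat := `|mul (gbasis h) (gbasis k) g|%N.
Definition abs_unit (g : G) : nat := `|e g|%N.

Lemma abs_constsE h k g : mul (gbasis h) (gbasis k) g = (abs_consts h k g)%:Z.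
Proof. by rewrite /abs_consts gez0_abs ?nn.1. Qed.

Lemma abs_unitE : e = unit_const abs_unit.
Proof. by apply/ffunP => g; rewrite ffunE /abs_unit gez0_abs ?nn.2. Qed.

Lemma mul_const_abs_consts : mul =2 mul_const abs_consts.
Proof.
move=> a b; move: a; apply: ZG_additive_ext => [x y|x y|h]; rewrite ?mulDl ?mul_constDl //.
move: b; apply: ZG_additive_ext => [x y|x y|k]; rewrite ?mulDr ?mul_constDr //.
by apply/ffunP => g; rewrite mul_const_gbasis abs_constsE.
Qed.

End NonnegRing.

Lemma sesquialgebra_of_nonneg_ring (k : fieldType) (G : finType)
    (mul : ZG G -> ZG G -> ZG G) (e : ZG G) :
  unital_ring_on mul e -> nonneg_consts mul e ->
  exists (D : fmod k ((G * G) * G)%type) (E : fmod k G),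
    [/\ sesquialgebra D E,
        forall h k0 g, mul (gbasis h) (gbasis k0) g = (dcoef D h k0 g)%:Z
      & forall g, e g = (ecoef E g)%:Z].
Proof.
move=> ring nn; have [mulDl mulDr _ _ _] := ring.
pose D := fmod_of_rank k (fun x : (G * G) * G => abs_consts mul x.1.1 x.1.2 x.2).
pose E := fmod_of_rank k (abs_unit e).
have dcoefD h k0 g : dcoef D h k0 g = abs_consts mul h k0 g by apply: mxrank_fmod_of_rank.
have ecoefE g : ecoef E g = abs_unit e g by apply: mxrank_fmod_of_rank.
exists D, E; split=> [|h k0 g|g]; last 2 first.
- by rewrite dcoefD (abs_constsE nn).
- by rewrite ecoefE {1}(abs_unitE nn) ffunE.
apply/sesquialgebraP; split; try exact/is_fmodP/complete_idempotents_fmod_of_rank.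
apply: eq_unital_assoc_consts (fun h k0 g => esym (dcoefD h k0 g)) (fun g => esym (ecoefE g)) _.
apply: unital_assoc_consts_of_ring; rewrite -(abs_unitE nn).
exact: eq_unital_ring_on (mul_const_abs_consts mulDl mulDr nn) ring.
Qed.

Lemma sesqui_isoP (k : fieldType) (G : finType)
    (D D' : fmod k ((G * G) * G)%type) (E E' : fmod k G) :
  is_fmod D -> is_fmod D' -> is_fmod E -> is_fmod E' ->
  sesqui_iso D D' E E' <->
  (forall h k0 g, dcoef D h k0 g = dcoef D' h k0 g) /\ (forall g, ecoef E g = ecoef E' g).
Proof.
move=> /is_fmodP cD /is_fmodP cD' /is_fmodP cE /is_fmodP cE'.
split=> [[/(qiso_qmod_ofP cD cD') eD /(qiso_qmod_ofP cE cE') eE]|[eD eE]].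
  by split=> // h k0 g; apply: (eD (h, k0, g)).
by split; apply/qiso_qmod_ofP => // -[[h k0] g]; apply: eD.
Qed.

Theorem proposition6p1 (k : fieldType) (G : finType) :
  (forall (D : fmod k ((G * G) * G)%type) (E : fmod k G),
      sesquialgebra D E ->
      unital_ring_on (mul_of D) (unit_of E) /\ nonneg_consts (mul_of D) (unit_of E))
  /\
  (forall (mul : ZG G -> ZG G -> ZG G) (e : ZG G),
      unital_ring_on mul e -> nonneg_consts mul e ->
      exists (D : fmod k ((G * G) * G)%type) (E : fmod k G),
        [/\ sesquialgebra D E,
            forall h k0 g, mul (gbasis h) (gbasis k0) g = (dcoef D h k0 g)%:Z
          & forall g, e g = (ecoef E g)%:Z])
  /\
  (forall (D D' : fmod k ((G * G) * G)%type) (E E' : fmod k G),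
      sesquialgebra D E -> sesquialgebra D' E' ->
      (sesqui_iso D D' E E' <->
       ((forall h k0 g, dcoef D h k0 g = dcoef D' h k0 g) /\
        (forall g, ecoef E g = ecoef E' g)))).
Proof.
split; [|split].
- move=> D E /sesquialgebraP[_ _ consts].
  by split; [exact: unital_ring_mul_const | exact: nonneg_consts_mul_const].
- exact: sesquialgebra_of_nonneg_ring.
- move=> D D' E E' /sesquialgebraP[iD iE _] /sesquialgebraP[iD' iE' _].
  exact: sesqui_isoP.
Qed.
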